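(* Let $H\leq F_m$ be a non-trivial finitely generated subgroup. Then $\mathcal{D}_H$ is the essential part of $\mathcal{A}_H=\mathcal{A}_{\widehat\Delta_H}\times\mathcal{A}_{F_m}$; that is, $\mathcal{D}_H$ is the (unique) essential subautomaton of $\mathcal{A}_H$ recognizing $L(\mathcal{A}_H)$. In particular, $L_H=L(\mathcal{D}_H)$.
   Context: Automata. A finite automaton $\mathcal{A}=(Q,\Sigma,\delta,\mathcal{I},\mathcal{F})$ has a finite set of states $Q$, alphabet $\Sigma$, transition function $\delta:Q\times\Sigma\to 2^Q$, initial states $\mathcal{I}\subseteq Q$ and final states $\mathcal{F}\subseteq Q$. Its Moore diagram is the directed graph on $Q$ with an edge labelled $x$ from $q$ to $q'$ whenever $q'\in\delta(q,x)$. An admissible path is a directed path (possibly of length $0$) from an initial to a final state; $L(\mathcal{A})$ is the set of labels of admissible paths. A subautomaton of $\mathcal{A}$ is an automaton whose Moore diagram (with its initial and final states) is a subdiagram of that of $\mathcal{A}$, with initial (final) states among those of $\mathcal{A}$; automata are identified with their Moore diagrams. $\mathcal{A}$ is essential if every vertex of its Moore diagram lies on an admissible path. An essential part of $\mathcal{A}$ is an essential subautomaton $\mathcal{A}'$ with $L(\mathcal{A}')=L(\mathcal{A})$; it is unique when every word of $L(\mathcal{A})$ labels a unique admissible path (as holds for $\mathcal{A}_H$). Free group and core. $A=\{a_1,\dots,a_m\}$ is a fixed basis of $F_m$ and $\Sigma=A\cup A^{-1}$. A word over $\Sigma$ is reduced if it has no subword $xx^{-1}$, $x\in\Sigma$.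 $L_H\subseteq\Sigma^*$ is the set of reduced words (including the empty word) representing elements of $H$. The extended Schreier graph $\widehat\Gamma$ of $H$ has as vertices the right cosets $Hg$, $g\in F_m$, with exactly one edge labelled $x$ from $Hg$ to $Hgx$ for every vertex $Hg$ and every $x\in\Sigma$. The root is $v_0=H$. The extended core $\widehat\Delta_H=(\widehat V,\widehat E,\widehat\mu)$ is the subgraph of $\widehat\Gamma$ consisting of $v_0$ and all vertices and edges lying on closed paths based at $v_0$ with reduced label; it is finite when $H$ is finitely generated. $\widehat\mu(e),t(e)$ are the label and terminus of an edge $e$. The automata. $\mathcal{A}_{\widehat\Delta_H}$ has Moore diagram $\widehat\Delta_H$ and $v_0$ as its only initial and only final state. $\mathcal{A}_{F_m}$ has states $Q_{F_m}=\{q_0\}\cup\{q_i^{\epsilon}\mid a_i^{\epsilon}\in\Sigma\}$, all of them final, initial state $q_0$, and transitions $\delta(q_0,a_j^{\epsilon'})=q_j^{\epsilon'}$ for all $a_j^{\epsilon'}\in\Sigma$ and $\delta(q_i^{\epsilon},a_j^{\epsilon'})=q_j^{\epsilon'}$ if $a_i^{\epsilon}\neq(a_j^{\epsilon'})^{-1}$ (undefined otherwise). $\mathcal{A}_H=\mathcal{A}_{\widehat\Delta_H}\times\mathcal{A}_{F_m}$ has states $\widehat V\times Q_{F_m}$, initial state $(v_0,q_0)$, final states $\{v_0\}\times Q_{F_m}$, and on reading $x$ moves from $(v,q)$ to $(\delta_{\widehat\Delta_H}(v,x),\delta_{F_m}(q,x))$ when both components are defined, being undefined otherwise. $\mathcal{D}_H$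 is the subautomaton of $\mathcal{A}_H$ induced on the set of states $Q_{\mathcal{D}_H}=\{(v_0,q_0)\}\cup\{(v,q_i^{\epsilon})\mid v\in\widehat V,\ \exists e\in\widehat E\text{ with }\widehat\mu(e)=a_i^{\epsilon},\ t(e)=v\}$. *)

(* Defs.v *)
From HB Require Import structures.
From mathcomp Require Import all_boot.
From mathcomp Require Import boolp classical_sets functions cardinality.

Set Implicit Arguments.
Unset Strict Implicit.
Unset Printing Implicit Defensive.

Local Open Scope classical_set_scope.

(* A walk labelled w from v to v', in the labelled graph whose edges are the
   triples (v, x, v') with [e v x v'].  A vertex lies on a walk when it splits
   the walk into two walks, and an edge when it joins an initial and a final
   segment of the walk; this is how "lies on a path" is written below. *)
Fixpoint walk (T S : Type) (e : T -> S -> set T) (v : T) (w : seq S) (v' : T)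
    : Prop :=
  if w is x :: w' then exists2 u, e v x u & walk e u w' v' else v = v'.

Lemma walk_rcons (T S : Type) (e : T -> S -> set T) v w u x v' :
  walk e v w u -> e u x v' -> walk e v (rcons w x) v'.
Proof.
elim: w v => [|y w IHw] v /=; first by move=> -> ?; exists v'.
by case=> k vk kw uv; exists k => //; exact: IHw.
Qed.

(* Automata are identified with their Moore diagrams, and the states are a
   subset of an ambient type, so that subautomata can be compared by inclusion
   and two automata are equal iff their Moore diagrams are.
   Finiteness of the set of states is the predicate [finite_automaton]. *)
Record automaton (T : Type) (S : finType) := Automaton {
  states : set T;
  delta : T -> S -> set T;
  initial : set T;
  final : set T;
  delta_states : forall q x q', delta q x q' -> states q /\ states q';
  initial_states : initial `<=` states;
  final_states : final `<=` states
}.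

Definition finite_automaton (T : Type) (S : finType) (M : automaton T S) : Prop :=
  finite_set (states M).

Definition language (T : Type) (S : finType) (M : automaton T S) : set (seq S) :=
  [set w | exists i f, [/\ initial M i, final M f & walk (delta M) i w f]].

Definition subautomaton (T : Type) (S : finType) (M' M : automaton T S) : Prop :=
  [/\ states M' `<=` states M,
      forall q x, delta M' q x `<=` delta M q x,
      initial M' `<=` initial M
    & final M' `<=` final M].

Definition essential (T : Type) (S : finType) (M : automaton T S) : Prop :=
  forall q, states M q ->
    exists i f u u', [/\ initial M i, final M f,
      walk (delta M) i u q & walk (delta M) q u' f].

Definition essential_part (T : Type) (S : finType) (M' M : automaton T S) : Prop :=
  [/\ subautomaton M' M, essential M' & language M' = language M].

Section Constructions.
Variables (T U : Type) (S : finType).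

Definition product_delta (M : automaton T S) (N : automaton U S)
    (p : T * U) (x : S) : set (T * U) :=
  delta M p.1 x `*` delta N p.2 x.

Lemma product_delta_states (M : automaton T S) (N : automaton U S) p x p' :
  product_delta M N p x p' ->
  (states M `*` states N) p /\ (states M `*` states N) p'.
Proof.
by move=> [d1 d2]; case: (delta_states d1) (delta_states d2) => ? ? [].
Qed.

Lemma product_initial_states (M : automaton T S) (N : automaton U S) :
  initial M `*` initial N `<=` states M `*` states N.
Proof. by move=> p [i1 i2]; split; exact: initial_states. Qed.

Lemma product_final_states (M : automaton T S) (N : automaton U S) :
  final M `*` final N `<=` states M `*` states N.
Proof. by move=> p [i1 i2]; split; exact: final_states. Qed.

Definition product_automaton (M : automaton T S) (N : automaton U S) :
    automaton (T * U) S :=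
  Automaton (@product_delta_states M N) (@product_initial_states M N)
    (@product_final_states M N).

Definition induced_delta (M : automaton T S) (Q : set T) (q : T) (x : S) : set T :=
  [set q' | [/\ delta M q x q', Q q & Q q']].

Lemma induced_delta_states (M : automaton T S) (Q : set T) q x q' :
  induced_delta M Q q x q' -> (states M `&` Q) q /\ (states M `&` Q) q'.
Proof. by move=> [d Qq Qq']; case: (delta_states d). Qed.

Lemma induced_initial_states (M : automaton T S) (Q : set T) :
  initial M `&` Q `<=` states M `&` Q.
Proof. by move=> q [iq Qq]; split=> //; exact: initial_states. Qed.

Lemma induced_final_states (M : automaton T S) (Q : set T) :
  final M `&` Q `<=` states M `&` Q.
Proof. by move=> q [iq Qq]; split=> //; exact: final_states. Qed.

Definition induced_automaton (M : automaton T S) (Q : set T) : automaton T S :=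
  Automaton (@induced_delta_states M Q) (@induced_initial_states M Q)
    (@induced_final_states M Q).

End Constructions.

(* The alphabet A \cup A^-1: (i, false) stands for a_i, (i, true) for a_i^-1. *)
Definition letter (m : nat) : finType := ('I_m * bool)%type.

Definition linv (m : nat) (x : letter m) : letter m := (x.1, ~~ x.2).

Definition reduced (m : nat) (w : seq (letter m)) : Prop :=
  forall x : letter m, ~~ infix [:: x; linv x] w.

Section FreeGroup.
Variables (m : nat) (F : groupType) (a : 'I_m -> F).

Definition letter_val (x : letter m) : F :=
  if x.2 then (a x.1)^-1%g else a x.1.

Definition word_val (w : seq (letter m)) : F := (\prod_(x <- w) letter_val x)%g.

Definition free_basis : Prop :=
  forall g : F, exists! w : seq (letter m), reduced w /\ word_val w = g.

Definition subgroup (H : set F) : Prop := group_closed [in H].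

Definition finitely_generated (H : set F) : Prop :=
  exists2 X : set F, finite_set X & H = smallest subgroup X.

Definition L_ (H : set F) : set (seq (letter m)) :=
  [set w | reduced w /\ H (word_val w)].

Definition right_coset (H : set F) (g : F) : set F := [set (h * g)%g | h in H].

(* The extended Schreier graph.  Its vertices are the right cosets of H, all of
   which are reached from the root H; the root is H itself. *)
Definition schreier_edge (H : set F) (v : set F) (x : letter m) : set (set F) :=
  [set v' | exists2 g, v = right_coset H g
                     & v' = right_coset H (g * letter_val x)%g].

Definition core_vertex (H : set F) : set (set F) :=
  [set v | v = H \/
    exists u u', [/\ walk (schreier_edge H) H u v,
      walk (schreier_edge H) v u' H & reduced (u ++ u')]].

Definition core_edge (H : set F) (v : set F) (x : letter m) : set (set F) :=
  [set v' | exists u u', [/\ walk (schreier_edge H) H u v,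
      schreier_edge H v x v', walk (schreier_edge H) v' u' H
    & reduced (u ++ x :: u')]].

Lemma core_edge_vertex (H : set F) v x v' :
  core_edge H v x v' -> core_vertex H v /\ core_vertex H v'.
Proof.
move=> [u [u' [Hu Hx Hu' r]]]; split; right.
  by exists u, (x :: u'); split=> //; exists v'.
exists (rcons u x), u'; split=> //; last by rewrite cat_rcons.
exact: walk_rcons Hu Hx.
Qed.

Lemma core_root (H : set F) : [set H] `<=` core_vertex H.
Proof. by move=> _ ->; left. Qed.

Definition A_core (H : set F) : automaton (set F) (letter m) :=
  Automaton (@core_edge_vertex H) (@core_root H) (@core_root H).

(* States of the automaton of reduced words: None is q_0, and Some x is the
   state q_i^e for the letter x = a_i^e. *)
Definition free_delta (q : option (letter m)) (x : letter m) :
    set (option (letter m)) :=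
  [set q' | q' = Some x /\ if q is Some y then y <> linv x else True].

Definition A_free : automaton (option (letter m)) (letter m) :=
  @Automaton _ _ setT free_delta [set None] setT
    (fun _ _ _ _ => conj I I) (fun _ _ => I) (fun _ _ => I).

Definition A_ (H : set F) : automaton (set F * option (letter m)) (letter m) :=
  product_automaton (A_core H) A_free.

Definition D_states (H : set F) : set (set F * option (letter m)) :=
  [set (H, None)] `|`
  [set p | exists v x, p = (v, Some x) /\ exists v0, core_edge H v0 x v].

Definition D_ (H : set F) : automaton (set F * option (letter m)) (letter m) :=
  induced_automaton (A_ H) (D_states H).

End FreeGroup.

(* Main.v *)
(** Every transition of A_H ends in a state of D_H, so D_H contains every
admissible path of A_H.  Conversely a state (v, x) of D_H comes from an edge of
the core labelled x and ending at v, and a reduced closed path through that edge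
is an admissible path through (v, x).  As A_H is deterministic, an admissible
path is determined by its label, whence uniqueness.  Finally, the core is finite
because reducing a product of generators of H only shortcuts the closed path
that it labels. *)
Require Import Defs.
From mathcomp Require Import all_boot.
From mathcomp Require Import boolp classical_sets functions cardinality.

Set Implicit Arguments.
Unset Strict Implicit.
Unset Printing Implicit Defensive.

Local Open Scope classical_set_scope.

(** * Walks in labelled graphs *)

Section Walks.
Variables (T S : Type).
Implicit Types (e : T -> S -> set T).

Lemma walk_cat e v w1 w2 v' :
  walk e v (w1 ++ w2) v' <-> exists2 u, walk e v w1 u & walk e u w2 v'.
Proof.
elim: w1 v => [|x w1 IH] v /=; first by split=> [?|[u ->]//]; exists v.
split=> [[k vk /IH[u ku uv']]|[u [k vk ku] uv']]; first by exists u => //; exists k.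
by exists k => //; apply/IH; exists u.
Qed.

Lemma walk_sub e e' : (forall v x, e v x `<=` e' v x) ->
  forall v w v', walk e v w v' -> walk e' v w v'.
Proof.
move=> ee' v w; elim: w v => //= x w IH v v' [u vu uv'].
by exists u; [exact: ee'|exact: IH].
Qed.

Lemma walk_functional e :
  (forall v x u u', e v x u -> e v x u' -> u = u') ->
  forall v w u u', walk e v w u -> walk e v w u' -> u = u'.
Proof.
move=> fe v w u u'; elim: w v => [v -> -> //|x w IH v /= [k vk ku] [l vl lu']].
by rewrite -(fe _ _ _ _ vk vl) in lu'; exact: IH ku lu'.
Qed.

End Walks.

(** * Essential parts of deterministic automata *)

Section Automata.
Variables (T : Type) (S : finType).
Implicit Types M N A : automaton T S.

Definition deterministic A : Prop :=
  (forall i j, initial A i -> initial A j -> i = j) /\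
  (forall v x u u', delta A v x u -> delta A v x u' -> u = u').

Lemma subautomaton_anti M N : subautomaton M N -> subautomaton N M -> M = N.
Proof.
case: M N => [s d i f ds is_ fs] [s' d' i' f' ds' is' fs'] [/= ss dd ii ff]
  [/= ss' dd' ii' ff'].
have E1 : s = s' by apply/seteqP; split.
have E2 : d = d'.
  by apply/funext => q; apply/funext => x; apply/seteqP; split; [exact: dd|exact: dd'].
have E3 : i = i' by apply/seteqP; split.
have E4 : f = f' by apply/seteqP; split.
subst; congr Automaton; exact: Prop_irrelevance.
Qed.

Lemma subautomaton_walk M A v w v' :
  subautomaton M A -> walk (delta M) v w v' -> walk (delta A) v w v'.
Proof. by case=> _ dd _ _; exact: walk_sub. Qed.

(* In a deterministic automaton an admissible path is determined by its label,
   so [N] contains every admissible path of [M]; as [M] is essential, these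
   cover all of [M]. *)
Lemma essential_part_sub A M N : deterministic A ->
  essential_part M A -> essential_part N A -> subautomaton M N.
Proof.
move=> [detI detD] [subM essM LM] [subN essN LN].
have common i u q u' f : initial M i -> final M f -> walk (delta M) i u q ->
    walk (delta M) q u' f ->
    exists f', [/\ initial N i, final N f', walk (delta N) i u q
      & walk (delta N) q u' f'] /\ f = f'.
  move=> Mi Mf iq qf.
  have : language N (u ++ u').
    by rewrite LN -LM; exists i, f; split=> //; apply/walk_cat; exists q.
  case=> j [f' [Nj Nf' /walk_cat[q' jq' q'f']]]; exists f'.
  have [_ _ iM _] := subM; have [_ _ iN _] := subN.
  have E := detI _ _ (iM _ Mi) (iN _ Nj); subst j.
  have E := walk_functional detD (subautomaton_walk subM iq)
    (subautomaton_walk subN jq').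
  subst q'; split=> //.
  exact: walk_functional detD _ _ _ _ (subautomaton_walk subM qf)
    (subautomaton_walk subN q'f').
have walk_states u i q : states N i -> walk (delta N) i u q -> states N q.
  elim: u i => [i ? <- //|x u IH i _ /= [k ik]]; apply: IH.
  by case: (delta_states ik).
split.
- move=> q /essM[i [f [u [u' [Mi Mf iq qf]]]]].
  have [f' [[Ni _ iqN _] _]] := common _ _ _ _ _ Mi Mf iq qf.
  exact: walk_states (initial_states Ni) iqN.
- move=> q x q' qq'; have [Mq Mq'] := delta_states qq'.
  have [i [_ [u [_ [Mi _ iq _]]]]] := essM _ Mq.
  have [_ [f [_ [u' [_ Mf _ q'f]]]]] := essM _ Mq'.
  (* An admissible path through the edge is glued from one reaching [q] and one leaving [q']. In [N]
     its label again splits at [q], and determinism identifies the next state with [q']. *)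
  have qf : walk (delta M) q (x :: u') f by exists q'.
  have [f' [[_ _ iqN [q'' qq'' _]] _]] := common _ _ _ _ _ Mi Mf iq qf.
  have [_ /(_ _ _ _ qq') dM _ _] := subM.
  have [_ /(_ _ _ _ qq'') dN _ _] := subN.
  by rewrite (detD _ _ _ _ dM dN).
- move=> i Mi; have [_ [f [_ [u' [_ Mf _ iF]]]]] := essM _ (initial_states Mi).
  by have [f' [[]]] := common i [::] i u' f Mi Mf erefl iF.
- move=> f Mf; have [i [_ [u [_ [Mi _ iF _]]]]] := essM _ (final_states Mf).
  by have [f' [[_ ? _ _] ->]] := common i u f [::] f Mi Mf iF erefl.
Qed.

Lemma essential_part_unique A M N : deterministic A ->
  essential_part M A -> essential_part N A -> M = N.
Proof.
by move=> detA ? ?; apply: subautomaton_anti; exact: essential_part_sub detA _ _.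
Qed.

End Automata.

Lemma walk_product (T U : Type) (S : finType) (M : automaton T S)
    (N : automaton U S) v q w v' q' :
  walk (delta (product_automaton M N)) (v, q) w (v', q') <->
  walk (delta M) v w v' /\ walk (delta N) q w q'.
Proof.
elim: w v q => [|x w IH] v q; first by split=> [[-> ->]|[-> ->]].
split=> [[[k l] [/= vk ql] /IH[kv lq]]|[[k vk kv] [l ql lq]]].
  by split; [exists k|exists l].
by exists (k, l); [split|apply/IH].
Qed.

(** * Reduced words as label sequences of [A_free] *)

Section ReducedWords.
Variable m : nat.
Implicit Types (x y : letter m) (w : seq (letter m)).

Lemma linvK : involutive (@linv m).
Proof. by case=> i b; rewrite /linv /= negbK. Qed.

(** A boolean relation on adjacent letters, so that reducedness becomes [sorted] and can be cut with
    the lemmas on [path]. *)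
Definition compatible : rel (letter m) := fun x y => y != linv x.

Lemma reduced_cons x w :
  reduced (x :: w) <->
  (if w is y :: _ then compatible x y else true) = true /\ reduced w.
Proof.
rewrite /reduced /compatible; split=> [rw|[xw rw] z].
  split=> [|z]; last by have := rw z; rewrite /= negb_or => /andP[].
  case: w rw => // y w /(_ x); rewrite /= negb_or eqxx prefix0s andbT => /andP[+ _].
  by rewrite eq_sym.
rewrite infix_consl negb_or rw andbT; case: w xw {rw} => [|y w] xy /=.
  by rewrite andbF.
by rewrite prefix0s andbT; case: eqP => //= ->; rewrite eq_sym.
Qed.

Lemma reducedE w : reduced w <-> sorted compatible w.
Proof.
elim: w => [|x w IH]; first by split=> // _ x.
rewrite reduced_cons IH; case: w {IH} => [|y w] /=; first by split=> [[]|].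
by split=> [[-> ->]|/andP[]].
Qed.

Lemma walk_free q w q' :
  walk (delta (A_free m)) q w q' <->
  q' = last q (map Some w) /\
  (if q is Some y then path compatible y w else sorted compatible w).
Proof.
(* The automaton tests [y <> linv x] where [compatible y x] tests [x != linv y]; the two agree
   because [linv] is an involution. *)
have aux y v r : walk (delta (A_free m)) (Some y) v r <->
    r = last (Some y) (map Some v) /\ path compatible y v.
  elim: v y r => [|x v IH] y r; first by split=> [|[]].
  split=> [[_ [-> yx]] /IH[-> xv]|[-> /andP[/eqP yx xv]]].
    split=> //=; rewrite xv andbT /compatible.
    by apply/eqP => E; apply: yx; rewrite E linvK.
  exists (Some x); last exact/IH.
  by split=> // E; apply: yx; rewrite E linvK.
case: q => [y|]; first exact: aux.
case: w => [|x w]; first by split=> [|[]].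
by split=> [[_ [-> _]] /aux|/aux ?] //; exists (Some x).
Qed.

End ReducedWords.

(** * Values of words and free reduction *)

Section Schreier.
Variables (m : nat) (F : groupType) (a : 'I_m -> F).
Implicit Types (w : seq (letter m)) (g h : F).
Local Open Scope group_scope.

Lemma word_val_cat w1 w2 : word_val a (w1 ++ w2) = word_val a w1 * word_val a w2.
Proof. by rewrite /word_val big_cat. Qed.

Lemma word_val_cons x w : word_val a (x :: w) = letter_val a x * word_val a w.
Proof. by rewrite /word_val big_cons. Qed.

Lemma word_val_nil : word_val a [::] = 1.
Proof. by rewrite /word_val big_nil. Qed.

Lemma letter_valV (x : letter m) : letter_val a (linv x) = (letter_val a x)^-1.
Proof. by case: x => i [] //=; rewrite /letter_val /= invgK. Qed.

Definition word_inv w : seq (letter m) := rev (map (@linv m) w).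

Lemma word_val_inv w : word_val a (word_inv w) = (word_val a w)^-1.
Proof.
elim: w => [|x w IH]; first by rewrite /word_inv /= word_val_nil invg1.
rewrite /word_inv /= rev_cons -cats1 word_val_cat IH !word_val_cons word_val_nil.
by rewrite mulg1 letter_valV invgM.
Qed.

Lemma word_invK : involutive word_inv.
Proof.
by move=> w; rewrite /word_inv map_rev revK mapK //; exact: linvK.
Qed.

(** Cancelling a pair of inverse letters only drops values from the list of prefix values. The set
    [P] varies in the induction because removing the first letter translates all prefix values. *)
Lemma reduce_word (P : set F) w :
    (forall p, prefix p w -> P (word_val a p)) ->
  exists w', [/\ reduced w', word_val a w' = word_val a w
    & forall p, prefix p w' -> P (word_val a p)].
Proof.
elim: w P => [|x w IH] P Pw; first by exists [::]; split=> //; exact/reducedE.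
have [|w' [rw' vw' Pw']] := IH [set g | P (letter_val a x * g)].
  by move=> p pw /=; rewrite -word_val_cons; apply: Pw; rewrite /= eqxx.
have [xw'|] := boolP (if w' is y :: _ then compatible x y else true).
  exists (x :: w'); split; first by apply/reduced_cons.
  - by rewrite !word_val_cons vw'.
  - move=> [_|y p /= /andP[/eqP -> pw']]; first exact: Pw.
    by rewrite word_val_cons; exact: Pw'.
case: w' => // y w' in rw' vw' Pw' *; rewrite negbK => /eqP yx.
(* Here [x] cancels against the head [y] of the reduced tail: the prefixes of what remains take
   values already taken by [x] followed by prefixes of the tail. *)
have val_tail s : word_val a s = letter_val a x * word_val a (y :: s).
  by rewrite word_val_cons yx letter_valV mulVKg.
exists w'; split; first by case/reduced_cons: rw'.
- by rewrite val_tail vw' word_val_cons.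
- by move=> p pw'; rewrite val_tail; apply: Pw'; rewrite /= eqxx.
Qed.

(** * Cosets, the Schreier graph and the core *)

Section Subgroup.
Variable H : set F.
Hypothesis subgroup_H : subgroup H.

Let H1 : H 1.
Proof. by case: subgroup_H => /set_mem. Qed.

Let HV h : H h -> H h^-1.
Proof. by move=> /mem_set Hh; apply/set_mem; exact: (group_closedV subgroup_H). Qed.

Let HM g h : H g -> H h -> H (g * h).
Proof.
move=> /mem_set Hg /mem_set Hh; apply/set_mem.
exact: (group_closedM subgroup_H).
Qed.

Lemma right_cosetMl h g : H h -> right_coset H (h * g) = right_coset H g.
Proof.
move=> Hh; apply/seteqP; split=> _ [k Hk <-].
  by exists (k * h); [exact: HM|rewrite mulgA].
by exists (k * h^-1); [apply: HM => //; exact: HV|rewrite !mulgA mulgVK].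
Qed.

Lemma right_coset1 : right_coset H 1 = H.
Proof.
apply/seteqP; split=> [_ [k Hk <-]|k Hk]; first by rewrite mulg1.
by exists k => //; rewrite mulg1.
Qed.

Lemma right_coset_id g : right_coset H g = H <-> H g.
Proof.
split=> [<-|Hg]; first by exists 1 => //; rewrite mul1g.
by rewrite -[g]mulg1 right_cosetMl // right_coset1.
Qed.

Lemma schreier_edgeE g (x : letter m) v :
  schreier_edge a H (right_coset H g) x v <->
  v = right_coset H (g * letter_val a x).
Proof.
split=> [[g' E ->]|->]; last by exists g.
(* Right translation acts on cosets, so the terminus of an edge does not depend on the
   representative chosen for its origin. *)
have rcM k l : right_coset H (k * l) = (fun y => y * l) @` right_coset H k.
  rewrite /right_coset image_comp; apply: eq_imagel => h _ /=.
  by rewrite mulgA.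
by rewrite !rcM E.
Qed.

Lemma walk_schreier g w v :
  walk (schreier_edge a H) (right_coset H g) w v <->
  v = right_coset H (g * word_val a w).
Proof.
elim: w g => [|x w IH] g /=; first by rewrite word_val_nil mulg1; split.
rewrite word_val_cons mulgA; split=> [[_ /schreier_edgeE -> /IH]|vE] //.
by exists (right_coset H (g * letter_val a x)); [exact/schreier_edgeE|apply/IH].
Qed.

Lemma walk_root w v :
  walk (schreier_edge a H) H w v <-> v = right_coset H (word_val a w).
Proof. by rewrite -{2}right_coset1 walk_schreier mul1g. Qed.

Lemma schreier_functional v (x : letter m) u u' :
  schreier_edge a H v x u -> schreier_edge a H v x u' -> u = u'.
Proof. by move=> [g -> ->] /schreier_edgeE ->. Qed.

Lemma core_schreier v (x : letter m) : core_edge a H v x `<=` schreier_edge a H v x.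
Proof. by move=> v' [u [u' []]]. Qed.

(** Every edge read along [s] lies on the single reduced closed path labelled [u ++ s ++ t]; the
    induction moves letters from [s] to the end of [u]. *)
Lemma walk_core v v' u s t : reduced (u ++ s ++ t) ->
  walk (schreier_edge a H) H u v -> walk (schreier_edge a H) v s v' ->
  walk (schreier_edge a H) v' t H -> walk (core_edge a H) v s v'.
Proof.
elim: s v u => [//|x s IH] v u rw Hv /= [k vk kv'] v'H.
exists k; first by exists u, (s ++ t); split=> //; apply/walk_cat; exists v'.
by apply: (IH _ (rcons u x)); rewrite ?cat_rcons //; exact: walk_rcons vk.
Qed.

(** * The automata [A_] and [D_]: determinism, languages and essentiality *)

Lemma deterministic_A : deterministic (A_ a H).
Proof.
split=> [[i1 i2] [j1 j2] [/= -> ->] [/= -> ->] //|[v q] x [u r] [u' r']].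
move=> [/= /core_schreier vu [-> _]] [/= /core_schreier vu' [-> _]].
by rewrite (schreier_functional vu vu').
Qed.

(** The second component of [p'] is the letter just read, which labels the core edge just
    followed. *)
Lemma D_states_delta p x p' : delta (A_ a H) p x p' -> D_states a H p'.
Proof.
case: p p' => v q [v' q'] [/= vv' [-> _]].
by right; exists v', x; split=> //; exists v.
Qed.

Lemma D_states_walk p w p' : D_states a H p ->
  walk (delta (A_ a H)) p w p' -> D_states a H p'.
Proof.
elim: w p => [p Dp <- //|x w IH p _ [k pk kp']].
exact: IH (D_states_delta pk) kp'.
Qed.

Lemma walk_D p w p' : D_states a H p ->
  walk (delta (A_ a H)) p w p' -> walk (delta (D_ a H)) p w p'.
Proof.
elim: w p => // x w IH p Dp [k pk kp']; have Dk := D_states_delta pk.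
by exists k => //; exact: IH.
Qed.

Lemma subautomaton_D : subautomaton (D_ a H) (A_ a H).
Proof. by split=> [q []|q x q' []|q []|q []]. Qed.

Lemma language_A : language (A_ a H) = L_ a H.
Proof.
apply/seteqP; split=> [w [[i1 i2] [[f1 f2] [[/= -> ->] [/= -> _]]]]|w [rw Hw]].
  case/walk_product => Hcore /walk_free[_ sw].
  split; first exact/reducedE.
  by apply/right_coset_id/esym/walk_root; exact: walk_sub core_schreier _ _ _ Hcore.
exists (H, None), (H, last None (map Some w)); split=> //.
apply/walk_product; split; last by apply/walk_free; split=> //; exact/reducedE.
(* A reduced word with value in [H] labels a closed path at the root, which itself witnesses that
   its edges are in the core. *)
apply: (@walk_core _ _ [::] w [::]); rewrite ?cats0 //.
by apply/walk_root/esym/right_coset_id.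
Qed.

Lemma language_D : language (D_ a H) = L_ a H.
Proof.
rewrite -language_A; apply/seteqP; split=> w [i [f [Di Df iF]]].
  exists i, f; split; [by case: Di|by case: Df|].
  exact: subautomaton_walk subautomaton_D iF.
have DH : D_states a H (H, None) by left.
have Ei : i = (H, None) by case: i Di {iF} => i1 i2 [/= -> ->].
subst i; exists (H, None), f; split=> //; last exact: walk_D.
by split=> //; exact: D_states_walk iF.
Qed.

Lemma essential_D : essential (D_ a H).
Proof.
have DH : D_states a H (H, None) by left.
move=> q [_ [->|[v [x [-> [v0 [u [u' [Hv0 v0v vH rw]]]]]]]]].
  by exists (H, None), (H, None), [::], [::].
(* The reduced closed path through the edge is cut just after [x]: the first half ends in state
   [(v, Some x)] and the second half starts there. *)
have Hv : walk (schreier_edge a H) H (rcons u x) v by exact: walk_rcons v0v.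
have rw' : reduced (rcons u x ++ u') by rewrite cat_rcons.
have toH : walk (delta (A_ a H)) (H, None) (rcons u x) (v, Some x).
  apply/walk_product; split; first exact: (@walk_core _ _ [::] _ u').
  apply/walk_free; split; first by rewrite map_rcons last_rcons.
  by move/reducedE: rw'; rewrite -cats1; case: u {Hv0 rw Hv} => [|y u] //=;
    rewrite !cat_path => /andP[].
have fromv : walk (delta (A_ a H)) (v, Some x) u' (H, last (Some x) (map Some u')).
  apply/walk_product; split.
    by apply: (@walk_core _ _ (rcons u x) _ [::]); rewrite ?cats0.
  apply/walk_free; split=> //; move/reducedE: rw.
  by case: u {Hv0 rw' Hv toH} => [|y u] //=; rewrite cat_path /= => /and3P[].
have Dv : D_states a H (v, Some x).
  by right; exists v, x; split=> //; exists v0, u, u'.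
exists (H, None), (H, last (Some x) (map Some u')), (rcons u x), u'.
split; [by split|split=> //|exact: walk_D|exact: walk_D].
exact: D_states_walk fromv.
Qed.

(** * Finiteness of the core *)

(** As [P] is stable under left multiplication by [H], membership depends only on the coset, that
    is, on the vertex reached. Words whose paths from the root stay in [P] and return to it can be
    concatenated and reversed, so the elements of [H] they represent form a subgroup [K]. *)
Lemma smallest_subgroup_prefixes (X P : set F) :
    P 1 -> (forall h g, H h -> P g -> P (h * g)) -> X `<=` H ->
    (forall g, X g -> exists2 w, word_val a w = g
       & forall p, prefix p w -> P (word_val a p)) ->
  forall g, smallest (@subgroup F) X g -> exists2 w, word_val a w = g
    & forall p, prefix p w -> P (word_val a p).
Proof.
move=> P1 PM XH XP.
pose K := [set g | H g /\ exists2 w, word_val a w = g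
  & forall p, prefix p w -> P (word_val a p)].
suff KX : subgroup K.
  by move=> g /(_ K)[] //; split=> // x Xx; split; [exact: XH|exact: XP].
split.
  apply/mem_set; split=> //; exists [::]; rewrite ?word_val_nil // => -[|//] _.
  by rewrite word_val_nil.
move=> g h /set_mem[Hg [wg vg Pg]] /set_mem[Hh [wh vh Ph]]; apply/mem_set.
split; first by apply: HM => //; exact: HV.
exists (wg ++ word_inv wh); first by rewrite word_val_cat word_val_inv vg vh.
(* A prefix of [wg ++ word_inv wh] either lies within [wg] or runs back along [wh]; in the latter
   case it ends at the vertex reached by a prefix of [wh]. *)
move=> p /prefixP[s]; have [le_p|lt_p] := leqP (size p) (size wg) => E.
  apply: Pg; rewrite prefixE; move: (congr1 (take (size p)) E).
  by rewrite (takel_cat _ le_p) (take_size_cat s erefl) => ->.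
have {E} [q -> E] : exists2 q, p = wg ++ q & word_inv wh = q ++ s.
  exists (drop (size wg) p).
    rewrite -[LHS](cat_take_drop (size wg)); congr (_ ++ _).
    have := congr1 (take (size wg)) E.
    by rewrite (take_size_cat _ erefl) (takel_cat _ (ltnW lt_p)) => <-.
  have := congr1 (drop (size wg)) E.
  by rewrite (drop_size_cat _ erefl) drop_cat lt_p.
have Eh : wh = word_inv s ++ word_inv q.
  by rewrite -[wh]word_invK E /word_inv map_cat rev_cat.
have -> : word_val a (wg ++ q) = (g * h^-1) * word_val a (word_inv s).
  rewrite word_val_cat vg -vh Eh word_val_cat [word_val a (word_inv q)]word_val_inv.
  by rewrite invgM invgK -!mulgA mulVg mulg1.
apply: PM; first by apply: HM => //; exact: HV.
by apply: Ph; rewrite Eh prefix_prefix.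
Qed.

Lemma finite_core : free_basis a -> finitely_generated H ->
  finite_set (core_vertex a H).
Proof.
move=> basis_a [X finX HX].
have /choice[wd wdP] : forall g, exists w, word_val a w = g.
  by move=> g; have [w [[_ ?] _]] := basis_a g; exists w.
(* The root and the vertices visited by the paths from the root labelled by the chosen words of the
   generators. *)
pose V := H |` \bigcup_(g in X)
  [set right_coset H (word_val a (take i (wd g))) | i in `I_(size (wd g)).+1].
have finV : finite_set V.
  rewrite finite_setU; split; first exact: finite_set1.
  by apply: bigcup_finite => // g _; apply: finite_image; exact: finite_II.
apply: sub_finite_set finV => v [->|[u [u' [/walk_root -> uH rw]]]]; first by left.
have Hw : H (word_val a (u ++ u')).
  apply/right_coset_id; rewrite word_val_cat; exact/esym/walk_schreier.
have XH : X `<=` H by rewrite HX; exact: sub_smallest.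
have [||||w vw Pw] := @smallest_subgroup_prefixes X
    [set g | V (right_coset H g)] _ _ XH _ (word_val a (u ++ u')).
- by left; rewrite right_coset1.
- by move=> h g Hh /=; rewrite right_cosetMl.
- move=> g Xg; exists (wd g); first exact: wdP.
  move=> p /prefixP[s E]; right; exists g => //; exists (size p).
    by rewrite /= ltnS E size_cat leq_addr.
  by rewrite E (take_size_cat s erefl).
- by rewrite -HX.
have [w' [rw' vw' Pw']] := reduce_word Pw.
(* By uniqueness of reduced forms, reducing a product of generators and their inverses gives exactly
   [u ++ u'], so the vertex reached by its prefix [u] is in [V]. *)
have [w0 [_ uniq_w0]] := basis_a (word_val a (u ++ u')).
apply: (Pw' u).
rewrite -(uniq_w0 w') ?vw' // (uniq_w0 (u ++ u')) //; exact: prefix_prefix.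
Qed.

End Subgroup.
End Schreier.

Theorem proposition5p6 (m : nat) (F : groupType) (a : 'I_m -> F)
    (basis_a : free_basis a) (H : set F) (subgroup_H : subgroup H)
    (fg_H : finitely_generated H) (nontrivial_H : H <> set1 (1%g : F)) :
  [/\ finite_automaton (A_ a H),
      essential_part (D_ a H) (A_ a H),
      forall M : automaton (set F * option (letter m)) (letter m),
        essential_part M (A_ a H) -> M = D_ a H
    & L_ a H = language (D_ a H)].
Proof.
have essD : essential_part (D_ a H) (A_ a H).
  split; [exact: subautomaton_D|exact: essential_D|].
  by rewrite language_D ?language_A.
split=> //; last by rewrite language_D.
- by apply: finite_setX; [exact: finite_core|exact: finite_finset].
- by move=> M essM; apply: essential_part_unique essD => //; exact: deterministic_A.
Qed.
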